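(* For every $n\ge 1$, the poset $\mathcal{M}_n$ of bi-leveled trees with $n$ internal nodes is a lattice.
   Context: A planar rooted binary tree (binary tree) with $n$ internal nodes has $n+1$ leaves; $\mathcal{Y}_n$ denotes the set of these. The internal nodes of $t\in\mathcal{Y}_n$ are numbered $1,\dots,n$ from left to right (in-order: node $i$ is the one separating the $i$-th leaf from the $(i+1)$-st leaf). The nodes are also partially ordered by proximity to the root: $x\ge y$ if $x$ lies on the path from $y$ to the root, so the root is the maximal node (the node poset of $t$). An upper order ideal $\mathsf{T}$ of the node poset is a subset such that $y\in\mathsf{T}$ and $x>y$ imply $x\in\mathsf{T}$. $\mathcal{Y}_n$ carries the Tamari order: the partial order generated by the moves which replace a subtree of the form $((a\,b)\,c)$ by $(a\,(b\,c))$, the latter being larger ($a,b,c$ binary trees, possibly single leaves). Thus the left comb is the minimum and the right comb is the maximum. A bi-leveled tree $(t;\mathsf{T})$ with $n$ nodes is a tree $t\in\mathcal{Y}_n$ together with an upper order ideal $\mathsf{T}$ of its node poset such that $\mathsf{T}$ contains the leftmost node of $t$ (node $1$) as a minimal element of $\mathsf{T}$. Via the left-to-right numbering of nodes, $\mathsf{T}$ is regarded as a subset of $\{1,\dots,n\}$. $\mathcal{M}_n$ is the set of bi-leveled trees with $n$ nodes, partially ordered by: $(s;\mathsf{S})\le(t;\mathsf{T})$ if $s\le t$ in the Tamari order on $\mathcal{Y}_n$ and $\mathsf{T}\subseteq\mathsf{S}$. *)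

(* Defs.v *)
From HB Require Import structures.
From mathcomp Require Import all_boot all_order zify.

Set Implicit Arguments.
Unset Strict Implicit.
Unset Printing Implicit Defensive.

Import Order.TTheory.

Inductive btree : Type := BLeaf | BNode of btree & btree.

Fixpoint btree_code (t : btree) : GenTree.tree unit :=
  if t is BNode l r then GenTree.Node 0 [:: btree_code l; btree_code r]
  else GenTree.Leaf tt.

Fixpoint btree_decode (c : GenTree.tree unit) : btree :=
  if c is GenTree.Node _ [:: a; b] then BNode (btree_decode a) (btree_decode b)
  else BLeaf.

Lemma btree_codeK : cancel btree_code btree_decode.
Proof. by elim=> //= l -> r ->. Qed.

HB.instance Definition _ := Countable.copy btree (can_type btree_codeK).

Fixpoint internal_nodes (t : btree) : nat :=
  if t is BNode l r then (internal_nodes l + internal_nodes r).+1 else 0.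

(* Internal nodes are named by their in-order rank counted from 0, so the node  *)
(* separating the i-th leaf from the next one has index i.-1. [root_path t y]   *)
(* is the path from the root of t down to y, both included; it is only          *)
(* meaningful for y < internal_nodes t.                                         *)
Fixpoint root_path (t : btree) (y : nat) : seq nat :=
  if t is BNode l r then
    let k := internal_nodes l in
    k :: (if y < k then root_path l y
          else if y == k then [::]
          else [seq k.+1 + x | x <- root_path r (y - k.+1)])
  else [::].

Definition node_ge (t : btree) (x y : nat) : bool := x \in root_path t y.

(* One Tamari move ((a b) c) -> (a (b c)), at the root or inside a subtree.     *)
Fixpoint tamari_move (s t : btree) {struct s} : bool :=
  match s, t with
  | BNode l r, BNode l' r' =>
    [|| match l, r' with
        | BNode a b, BNode b' c' => [&& a == l', b == b' & r == c']
        | _, _ => false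
        end,
        tamari_move l l' && (r == r')
      | (l == l') && tamari_move r r']
  | _, _ => false
  end.

Record Ytree (n : nat) : Type := YTree {
  ytree :> btree;
  _ : internal_nodes ytree == n
}.

HB.instance Definition _ n := [isSub for @ytree n].
HB.instance Definition _ n := [Countable of Ytree n by <:].

Lemma ytree_nodes n (t : Ytree n) : internal_nodes t = n.
Proof. by case: t => t /= /eqP. Qed.

(* [low_trees h] lists the trees of height at most h. *)
Fixpoint low_trees (h : nat) : seq btree :=
  if h is h'.+1 then
    BLeaf :: [seq BNode l r | l <- low_trees h', r <- low_trees h']
  else [:: BLeaf].

Lemma mem_low_trees h t : internal_nodes t <= h -> t \in low_trees h.
Proof.
elim: h t => [|h IHh] [|l r] //=; rewrite ltnS => le_lr.
by rewrite inE /=; apply: allpairs_f; apply: IHh;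
  apply: leq_trans le_lr; rewrite ?leq_addr ?leq_addl.
Qed.

Definition Ytree_enum n : seq (Ytree n) := undup (pmap insub (low_trees n)).

Lemma Ytree_enumP n : Finite.axiom (Ytree_enum n).
Proof.
apply: Finite.uniq_enumP; first exact: undup_uniq.
by move=> t; rewrite mem_undup mem_pmap_sub /= mem_low_trees ?ytree_nodes.
Qed.

HB.instance Definition _ n := isFinite.Build (Ytree n) (@Ytree_enumP n).

Definition tamari_le n : rel (Ytree n) :=
  connect (fun s t : Ytree n => tamari_move s t).

(* The sum of the sizes of all left subtrees decreases along Tamari moves; this *)
(* gives antisymmetry.                                                          *)
Fixpoint left_weight (t : btree) : nat :=
  if t is BNode l r then internal_nodes l + left_weight l + left_weight r else 0.

Lemma tamari_move_nodes s t :
  tamari_move s t -> internal_nodes s = internal_nodes t.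
Proof.
elim: s t => [|l IHl r IHr] [|l' r'] //= /or3P[].
- case: l r' {IHl IHr} => [|a b] [|b' c'] //= /and3P[/eqP-> /eqP-> /eqP->] /=.
  by lia.
- by case/andP=> /IHl-> /eqP->.
- by case/andP=> /eqP-> /IHr->.
Qed.

Lemma tamari_move_weight s t : tamari_move s t -> left_weight t < left_weight s.
Proof.
elim: s t => [|l IHl r IHr] [|l' r'] //= /or3P[].
- case: l r' {IHl IHr} => [|a b] [|b' c'] //= /and3P[/eqP-> /eqP-> /eqP->] /=.
  by lia.
- case/andP=> mv_l /eqP->; rewrite ltn_add2r (tamari_move_nodes mv_l) ltn_add2l.
  exact: IHl.
- by case/andP=> /eqP-> /IHr; rewrite ltn_add2l.
Qed.

Lemma tamari_le_weight n (s t : Ytree n) :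
  tamari_le s t -> (s == t) || (left_weight t < left_weight s).
Proof.
case/connectP=> p; elim: p s => [|u p IHp] s /=; first by move=> _ ->; rewrite eqxx.
case/andP=> /tamari_move_weight lt_us /IHp{}IHp /IHp/orP[/eqP <-|lt_tu].
  by rewrite lt_us orbT.
by rewrite (ltn_trans lt_tu lt_us) orbT.
Qed.

Lemma tamari_le_refl n : reflexive (@tamari_le n).
Proof. exact: connect0. Qed.

Lemma tamari_le_anti n : antisymmetric (@tamari_le n).
Proof.
move=> s t /andP[/tamari_le_weight/orP[/eqP//|lt_ts]].
by move=> /tamari_le_weight/orP[/eqP//|/(ltn_trans lt_ts)]; rewrite ltnn.
Qed.

Lemma tamari_le_trans n : transitive (@tamari_le n).
Proof. exact: connect_trans. Qed.

Fact tamari_display : Order.disp_t. Proof. exact. Qed.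

HB.instance Definition _ n := Order.Le_isPOrder.Build tamari_display (Ytree n)
  (@tamari_le_refl n) (@tamari_le_anti n) (@tamari_le_trans n).

Definition upper_ideal n (t : Ytree n) (T : {set 'I_n}) : bool :=
  [forall y in T, forall x : 'I_n, node_ge t x y ==> (x \in T)].

Definition minimal_in n (t : Ytree n) (T : {set 'I_n}) (x : 'I_n) : bool :=
  (x \in T) && [forall y in T, node_ge t x y ==> (y == x)].

(* The leftmost node has in-order rank 0. *)
Definition is_bileveled n (t : Ytree n) (T : {set 'I_n}) : bool :=
  upper_ideal t T && [exists i : 'I_n, (val i == 0) && minimal_in t T i].

Record bileveled (n : nat) : Type := Bileveled {
  bl_pair :> Ytree n * {set 'I_n};
  _ : is_bileveled bl_pair.1 bl_pair.2
}.

HB.instance Definition _ n := [isSub for @bl_pair n].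
HB.instance Definition _ n := [Finite of bileveled n by <:].

Definition bl_tree n (b : bileveled n) : Ytree n := (bl_pair b).1.
Definition bl_ideal n (b : bileveled n) : {set 'I_n} := (bl_pair b).2.

Definition bileveled_le n : rel (bileveled n) := fun s t =>
  (bl_tree s <= bl_tree t)%O && (bl_ideal t \subset bl_ideal s).

Lemma bileveled_le_refl n : reflexive (@bileveled_le n).
Proof. by move=> s; rewrite /bileveled_le lexx subxx. Qed.

Lemma bileveled_le_anti n : antisymmetric (@bileveled_le n).
Proof.
move=> s t /andP[/andP[le_st sub_ts] /andP[le_ts sub_st]]; apply: val_inj => /=.
rewrite [bl_pair s]surjective_pairing [bl_pair t]surjective_pairing.
congr (_, _); first by apply/le_anti/andP.
by apply/eqP; rewrite eqEsubset; apply/andP.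
Qed.

Lemma bileveled_le_trans n : transitive (@bileveled_le n).
Proof.
move=> t s u /andP[le_st sub_ts] /andP[le_tu sub_ut].
by rewrite /bileveled_le (le_trans le_st le_tu) (subset_trans sub_ut sub_ts).
Qed.

Fact bileveled_display : Order.disp_t. Proof. exact. Qed.

HB.instance Definition _ n :=
  Order.Le_isPOrder.Build bileveled_display (bileveled n)
    (@bileveled_le_refl n) (@bileveled_le_anti n) (@bileveled_le_trans n).

(* A latticeType whose underlying porderType, carrier and order included, is P. *)
Definition is_lattice d (P : porderType d) : Prop :=
  exists L : latticeType d, L = P :> porderType d.

(* Main.v *)
Require Import Defs.
From HB Require Import structures.
From mathcomp Require Import all_boot all_order zify.

Set Implicit Arguments.
Unset Strict Implicit.
Unset Printing Implicit Defensive.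

Import Order.TTheory.

(** Say that x is a left ancestor of y when x is an ancestor of y and y < x, that
    is, when y lies in the left subtree of x; right ancestors are those with
    x < y.  A Tamari move destroys left ancestries and creates right ones, and
    the left ancestries alone determine the order: s <= t exactly when every left
    ancestry of t is one of s ([tamari_leP]).  The relations that occur as the
    left ancestry of a tree are those which are transitive and convex
    ([tree_of_left_ancestry]).  Both properties pass to intersections, so the
    join J of s and t is the tree whose left ancestries are those common to s
    and t ([tamari_join]).

    The join of (s; S) and (t; T) lives on the same tree J.  Its ideal consists
    of the nodes y all of whose ancestors in J belong to both S and T, leaving
    out the proper descendants of node 0.  This is an upper ideal of J in which
    node 0 is minimal: the ancestors of node 0 in J are left ancestors, hence
    ancestors of node 0 in s and t, hence in S and in T.  To see that it gives
    the least upper bound, let (u; U) be any upper bound, and let x be an ancestor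
    in J of some y in U.  A left ancestry of J is one of s and of t, and S and T
    are upper ideals containing y; a right ancestry of J persists in u >= J,
    whence x is in U, a subset of S and of T.  Either way x is in S and T.
    For the same reason y is not a proper descendant of node 0 in J, because it
    is not one in u ([bileveled_join]).

    Finally M_n has a bottom, the left comb with all of its nodes, and a finite
    poset with a bottom and binary joins is a lattice: the meet of two elements
    is the join of their common lower bounds ([finite_join_lattice]). *)

(** * Ancestry in a binary tree *)

Lemma node_ge_node l r x y (k := internal_nodes l) :
  node_ge (BNode l r) x y =
  (x == k) || (if y < k then node_ge l x y
               else [&& k < x, k < y & node_ge r (x - k.+1) (y - k.+1)]).
Proof.
rewrite /node_ge /= inE -/k; case: (x == k) => //=.
case: (ltngtP y k) => [|lt_ky|_] //=; last by rewrite andbF.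
have [lt_kx|le_xk] := ltnP k x.
  by rewrite -[in LHS](subnKC lt_kx) mem_map //; apply: addnI.
by apply/mapP => -[z _ def_x]; move: le_xk; rewrite def_x; lia.
Qed.

Lemma node_ge_ltn t x y : node_ge t x y -> x < internal_nodes t.
Proof.
elim: t x y => [//|l IHl r IHr] x y; rewrite node_ge_node /=.
case/orP=> [/eqP->|]; first by lia.
case: ifP => [_ /IHl|_ /and3P[lt_x lt_y /IHr]]; lia.
Qed.

Lemma node_ge_left l r x y :
  x < internal_nodes l -> y < internal_nodes l ->
  node_ge (BNode l r) x y = node_ge l x y.
Proof. by move=> lt_x lt_y; rewrite node_ge_node lt_y ltn_eqF. Qed.

Lemma node_ge_right l r x y :
  node_ge (BNode l r) ((internal_nodes l).+1 + x) ((internal_nodes l).+1 + y)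
  = node_ge r x y.
Proof.
by rewrite node_ge_node !addKn; case: ifP; lia.
Qed.

Lemma node_ge_refl t y : y < internal_nodes t -> node_ge t y y.
Proof.
elim: t y => [//|l IHl r IHr] y /= lt_yn; rewrite node_ge_node.
case: (ltngtP y (internal_nodes l)) => //= lt_y; first exact: IHl.
by apply: IHr; lia.
Qed.

Lemma node_ge_trans t x y z : node_ge t x y -> node_ge t y z -> node_ge t x z.
Proof.
elim: t x y z => [//|l IHl r IHr] x y z; rewrite !node_ge_node.
set k := internal_nodes l; have [//|_ /=] := eqVneq x k.
have [lt_yk ge_xy|le_ky /and3P[lt_kx lt_ky ge_xy]] := ltnP y k.
  rewrite ltn_eqF //=; case: ltnP => [_|le_kz]; first exact: IHl.
  by case/andP; lia.
rewrite gtn_eqF //=; case: ltnP => [_ /node_ge_ltn|_ /and3P[_ lt_kz]]; first lia.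
by move=> ge_yz; rewrite lt_kx lt_kz (IHr _ _ _ ge_xy).
Qed.

Lemma node_ge_anti t x y : node_ge t x y -> node_ge t y x -> x = y.
Proof.
elim: t x y => [//|l IHl r IHr] x y; rewrite !node_ge_node.
set k := internal_nodes l.
case: (ltngtP x k) => [lt_xk|lt_kx|->] /=; case: (ltngtP y k) => //=.
- by move=> _; apply: IHl.
- by move=> lt_ky ge_xy ge_yx; have := IHr _ _ ge_xy ge_yx; lia.
Qed.

(** The left subtree of x occupies an interval of nodes that ends just before x. *)
Lemma node_ge_convex t x y z :
  y <= z -> z < x -> node_ge t x y -> node_ge t x z.
Proof.
elim: t x y z => [//|l IHl r IHr] x y z le_yz lt_zx; rewrite !node_ge_node.
set k := internal_nodes l; have [//|_ /=] := eqVneq x k.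
have [lt_yk ge_xy|le_ky /and3P[lt_kx lt_ky ge_xy]] := ltnP y k.
  by have:= node_ge_ltn ge_xy => lt_xk; rewrite ifT ?(IHl _ _ _ le_yz) //; lia.
by rewrite ifF; [rewrite lt_kx (IHr _ _ _ _ _ ge_xy) |]; lia.
Qed.

(** * Tamari moves and ancestry *)

(** Rotating ((a b) c) to (a (b c)) makes the root lose the root of (a b) and all
    of a as left descendants, and makes the root of (a b) gain the old root and all
    of c as right descendants; every other ancestry is unchanged. *)
Lemma tamari_move_left_anc s t x y :
  tamari_move s t -> y < x -> node_ge t x y -> node_ge s x y.
Proof.
elim: s t x y => [//|l IHl r IHr] [//|l' r'] x y /= /or3P[].
- case: l r' {IHl IHr} => [|a b] [|b' c] //= /and3P[/eqP<- /eqP<- /eqP->] lt_yx.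
  rewrite !node_ge_node /=; set A := internal_nodes a; set B := internal_nodes b.
  have -> : x - A.+1 - B.+1 = x - (A + B).+2 by lia.
  have -> : y - A.+1 - B.+1 = y - (A + B).+2 by lia.
  by do ![case: ifP]; lia.
- case/andP=> mv_l /eqP<- lt_yx; rewrite !node_ge_node (tamari_move_nodes mv_l).
  by case/orP=> [->//|]; case: ifP => _ ge_xy; rewrite ?ge_xy ?(IHl _ _ _ mv_l) ?orbT.
- case/andP=> /eqP<- mv_r lt_yx; rewrite !node_ge_node.
  case/orP=> [->//|]; case: ifP => [_ ->|_ /and3P[lt_x lt_y /(IHr _ _ _ mv_r)->]].
    by rewrite orbT.
    by rewrite lt_x lt_y orbT.
  by lia.
Qed.

Lemma tamari_move_right_anc s t x y :
  tamari_move s t -> x < y -> node_ge s x y -> node_ge t x y.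
Proof.
elim: s t x y => [//|l IHl r IHr] [//|l' r'] x y /= /or3P[].
- case: l r' {IHl IHr} => [|a b] [|b' c] //= /and3P[/eqP<- /eqP<- /eqP->] lt_yx.
  rewrite !node_ge_node /=; set A := internal_nodes a; set B := internal_nodes b.
  have -> : x - A.+1 - B.+1 = x - (A + B).+2 by lia.
  have -> : y - A.+1 - B.+1 = y - (A + B).+2 by lia.
  by do ![case: ifP]; lia.
- case/andP=> mv_l /eqP<- lt_xy; rewrite !node_ge_node (tamari_move_nodes mv_l).
  by case/orP=> [->//|]; case: ifP => _ ge_xy; rewrite ?ge_xy ?(IHl _ _ _ mv_l) ?orbT.
- case/andP=> /eqP<- mv_r lt_xy; rewrite !node_ge_node.
  case/orP=> [->//|]; case: ifP => [_ ->|_ /and3P[lt_x lt_y /(IHr _ _ _ mv_r)->]].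
    by rewrite orbT.
    by rewrite lt_x lt_y orbT.
  by lia.
Qed.

(** The closure of the moves on bare trees; unlike the order on [Ytree n], it
    makes sense on subtrees without keeping track of their sizes. *)
Inductive tamari_moves (s : btree) : btree -> Prop :=
| TamariRefl : tamari_moves s s
| TamariStep u t : tamari_moves s u -> tamari_move u t -> tamari_moves s t.

Lemma tamari_moves_trans s u t :
  tamari_moves s u -> tamari_moves u t -> tamari_moves s t.
Proof.
by move=> mv_su; elim=> // v w _ mv_sv; apply: TamariStep.
Qed.

Lemma tamari_moves_left s t r :
  tamari_moves s t -> tamari_moves (BNode s r) (BNode t r).
Proof.
elim=> [|u v _ mv_su mv_uv]; first exact: TamariRefl.
by apply: TamariStep mv_su _; rewrite /= mv_uv eqxx orbT.
Qed.

Lemma tamari_moves_right l s t :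
  tamari_moves s t -> tamari_moves (BNode l s) (BNode l t).
Proof.
elim=> [|u v _ mv_su mv_uv]; first exact: TamariRefl.
by apply: TamariStep mv_su _; rewrite /= mv_uv eqxx !orbT.
Qed.

Lemma tamari_moves_nodes s t :
  tamari_moves s t -> internal_nodes s = internal_nodes t.
Proof. by elim=> // u v _ ->; apply: tamari_move_nodes. Qed.

(** A node k that is an ancestor of node 0 lies on the left spine, and rotating
    it past the spine nodes above it makes it the root.  The only left ancestries
    lost are those of the spine nodes x > k over the nodes up to k, which no tree
    with root k has. *)
Lemma tamari_moves_lift s k : node_ge s k 0 ->
  exists l r, [/\ internal_nodes l = k, tamari_moves s (BNode l r)
    & forall x y, y < x -> ~~ (y <= k < x) -> node_ge s x y ->
                  node_ge (BNode l r) x y].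
Proof.
elim: s => [//|a IHa b _]; rewrite node_ge_node.
case/orP=> [/eqP->|]; first by exists a, b; split=> //; apply: TamariRefl.
case: ifP => [_ ge_k0|_ /and3P[]//]; have lt_ka := node_ge_ltn ge_k0.
have [l [c [sz_l mv_a ge_lc]]] := IHa ge_k0.
exists l, (BNode c b); split=> //.
  by apply: TamariStep (tamari_moves_left b mv_a) _; rewrite /= !eqxx.
have /= sz_a := tamari_moves_nodes mv_a.
move=> x y lt_yx nk_xy ge_xy; have := ge_lc x y lt_yx nk_xy; move: ge_xy.
rewrite !node_ge_node sz_l sz_a sz_l.
set K := (k + _).+1.
have -> : x - k.+1 - (internal_nodes c).+1 = x - K.+1 by lia.
have -> : y - k.+1 - (internal_nodes c).+1 = y - K.+1 by lia.
case/orP=> [/eqP def_x _|]; first by do ![case: ifP]; lia.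
case: ifP => [_ ge_xy /(_ ge_xy)|]; last by do ![case: ifP]; lia.
have := node_ge_ltn ge_xy; do ![case: ifP]; lia.
Qed.

(** The root k of t is an ancestor of node 0 in t, hence in s.  Lifting it to the
    root of s costs no left ancestry of t, and then the subtrees on either side of k
    can be compared separately. *)
Lemma left_anc_tamari_moves s t : internal_nodes s = internal_nodes t ->
  (forall x y, y < x -> node_ge t x y -> node_ge s x y) -> tamari_moves s t.
Proof.
elim: t s => [|tl IHl tr IHr] s sz_st ge_ts.
  by case: s sz_st {ge_ts} => // _; apply: TamariRefl.
set k := internal_nodes tl in IHl sz_st ge_ts.
have ge_sk0: node_ge s k 0.
  have [k0|k_gt0] := posnP k; first by rewrite k0 node_ge_refl // sz_st.
  by apply: ge_ts => //; rewrite node_ge_node eqxx.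
have [l [r [sz_l mv_s ge_lr]]] := tamari_moves_lift ge_sk0.
have {ge_ts}ge_t x y : y < x -> node_ge (BNode tl tr) x y -> node_ge (BNode l r) x y.
  move=> lt_yx ge_xy; apply: ge_lr (ge_ts _ _ lt_yx ge_xy) => //.
  apply/negP=> /andP[le_yk lt_kx]; move: ge_xy; rewrite node_ge_node -/k.
  rewrite gtn_eqF //=; case: ifP => [_ /node_ge_ltn|_ /and3P[]]; lia.
have sz_r : internal_nodes r = internal_nodes tr.
  by have := tamari_moves_nodes mv_s; rewrite /= sz_st /= sz_l -/k; lia.
apply: tamari_moves_trans mv_s (tamari_moves_trans (u := BNode tl r) _ _).
  apply/tamari_moves_left/IHl => // x y lt_yx ge_xy.
  have lt_xk := node_ge_ltn ge_xy; have lt_yk := ltn_trans lt_yx lt_xk.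
  by rewrite -(node_ge_left r) ?sz_l // ge_t // node_ge_left.
apply/tamari_moves_right/IHr => // x y lt_yx ge_xy.
rewrite -(node_ge_right l) sz_l; apply: ge_t; first by rewrite ltn_add2l.
by rewrite node_ge_right.
Qed.

(** Convexity and transitivity make the nodes related to 0 the left spine.  The
    root must be the last of these, k, because a left ancestor of any node up to k
    beyond k would by convexity and transitivity be one of 0. *)
Lemma tree_of_left_ancestry n (A : rel nat) :
    (forall x y z, y <= z -> z < x -> x < n -> A x y -> A x z) ->
    (forall x y z, z < y -> y < x -> x < n -> A x y -> A y z -> A x z) ->
  exists2 t, internal_nodes t = n
    & forall x y, y < x -> x < n -> node_ge t x y = A x y.
Proof.
have [m] := ubnP n; elim: m n A => // m IHm [|n] A le_nm convA transA.
  by exists BLeaf.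
pose P k := (k < n.+1) && ((k == 0) || A k 0).
have exP : exists k, P k by exists 0.
have ubP k : P k -> k <= n by case/andP; rewrite ltnS.
case: (ex_maxnP exP ubP) => k /andP[le_kn Ak0] max_k {exP ubP}.
have [|||l sz_l ge_l] := IHm k A; first by lia.
- by move=> x y z le_yz lt_zx lt_xk; apply: convA => //; lia.
- by move=> x y z lt_zy lt_yx lt_xk; apply: transA => //; lia.
have [|||r sz_r ge_r] := IHm (n - k) (fun x y => A (k.+1 + x) (k.+1 + y)).
- by lia.
- by move=> x y z le_yz lt_zx lt_xk; apply: convA; lia.
- by move=> x y z lt_zy lt_yx lt_xk; apply: transA; lia.
exists (BNode l r) => [|x y lt_yx lt_xn]; first by rewrite /= sz_l sz_r; lia.
rewrite node_ge_node sz_l; case: (ltngtP x k) => [lt_xk|lt_kx|eq_xk] /=.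
- by rewrite (ltn_trans lt_yx lt_xk) ge_l.
- have nA0 : ~~ A x 0.
    apply/negP=> Ax0; suff /max_k : P x by rewrite leqNgt lt_kx.
    by rewrite /P lt_xn Ax0 orbT.
  have nAk : ~~ A x k.
    have [k0|/eqP nk0] := eqVneq k 0; first by rewrite k0.
    apply: contra nA0 => Axk; apply: transA Axk _ => //; first by lia.
    by case/orP: Ak0 => // /eqP.
  have [lt_ky|le_yk] := ltnP k y.
    rewrite ltnNge ltnW //= ge_r; [|lia..].
    by rewrite !subnKC //; lia.
  have -> : A x y = false by apply: contraNF nAk; apply: convA.
  by case: ifP => // _; apply/negbTE/negP=> /node_ge_ltn; rewrite sz_l; lia.
- subst x; case/orP: Ak0 => [/eqP k0|Ak0]; first by lia.
  by rewrite (convA k 0).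
Qed.

(** * The Tamari order in terms of ancestries *)

Lemma tamari_le_left_anc n (s t : Ytree n) x y :
  (s <= t)%O -> y < x -> node_ge t x y -> node_ge s x y.
Proof.
move=> /connectP[p]; elim: p s => [|u p IHp] s /= => [_ ->//|/andP[mv_su pth]].
by move=> def_t lt_yx /(IHp _ pth def_t lt_yx); apply: tamari_move_left_anc.
Qed.

Lemma tamari_le_right_anc n (s t : Ytree n) x y :
  (s <= t)%O -> x < y -> node_ge s x y -> node_ge t x y.
Proof.
move=> /connectP[p]; elim: p s => [|u p IHp] s /= => [_ ->//|/andP[mv_su pth]].
move=> def_t lt_xy ge_xy; apply: (IHp _ pth def_t lt_xy).
exact: tamari_move_right_anc mv_su lt_xy ge_xy.
Qed.

Lemma tamari_moves_le n (s t : Ytree n) : tamari_moves s t -> (s <= t)%O.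
Proof.
move def_t: (ytree t) => t' mv_st; elim: mv_st t def_t => [|u v _ IHu mv_uv] t def_t.
  by have -> : t = s by apply: val_inj.
have sz_u : internal_nodes u == n.
  by rewrite (tamari_move_nodes mv_uv) -def_t ytree_nodes.
apply: le_trans (IHu (YTree sz_u) erefl) _.
by apply: connect1; rewrite /= def_t.
Qed.

Lemma tamari_leP n (s t : Ytree n) :
  (s <= t)%O <-> forall x y, y < x -> node_ge t x y -> node_ge s x y.
Proof.
split=> [le_st x y|ge_ts]; first exact: tamari_le_left_anc.
by apply/tamari_moves_le/left_anc_tamari_moves; rewrite ?ytree_nodes.
Qed.

Lemma tamari_join n (s t : Ytree n) : exists j : Ytree n,
  forall u : Ytree n, (j <= u)%O = (s <= u)%O && (t <= u)%O.
Proof.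
pose A x y := node_ge s x y && node_ge t x y.
have [x y z le_yz lt_zx _ /andP[sxy txy]||j sz_j ge_j] := @tree_of_left_ancestry n A.
- by rewrite /A !(node_ge_convex le_yz lt_zx).
- move=> x y z _ _ _ /andP[sxy txy] /andP[syz tyz].
  by rewrite /A (node_ge_trans sxy) // (node_ge_trans txy).
have sz_jb : internal_nodes j == n by apply/eqP.
have ge_jE x y : y < x -> node_ge j x y = A x y.
  move=> lt_yx; have [lt_xn|le_nx] := ltnP x n; first exact: ge_j.
  apply/idP/idP => [/node_ge_ltn|/andP[/node_ge_ltn]]; first by lia.
  by rewrite ytree_nodes; lia.
exists (YTree sz_jb) => u; apply/idP/andP => [/tamari_leP le_ju|[]].
  by split; apply/tamari_leP=> x y lt_yx /(le_ju _ _ lt_yx);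
    rewrite /= ge_jE // => /andP[].
move=> /tamari_leP le_su /tamari_leP le_tu; apply/tamari_leP=> x y lt_yx ge_xy.
by rewrite /= ge_jE // /A le_su ?le_tu.
Qed.

Lemma tamari_bottom n : exists c : Ytree n,
  forall x y, y < x -> x < n -> node_ge c x y.
Proof.
have [//|//|c sz_c ge_c] := @tree_of_left_ancestry n (fun _ _ => true).
have sz_cb : internal_nodes c == n by apply/eqP.
by exists (YTree sz_cb) => x y lt_yx lt_xn; rewrite ge_c.
Qed.

(** * Bi-leveled trees *)

Lemma is_bileveledP n (t : Ytree n.+1) (T : {set 'I_n.+1}) :
  reflect [/\ ord0 \in T,
              forall x y : 'I_n.+1, y \in T -> node_ge t x y -> x \in T
            & forall y : 'I_n.+1, y \in T -> node_ge t 0 y -> y = ord0]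
          (is_bileveled t T).
Proof.
apply: (iffP andP) =>
  [[/forall_inP upT /existsP[i /and3P[/eqP i0 Ti /forall_inP minT]]]|].
  have {i0}def_i : i = ord0 by apply: val_inj.
  rewrite {}def_i in Ti minT.
  split=> // [x y /upT/forallP/(_ x)/implyP//|y Ty ge_0y].
  by apply/eqP; have /implyP := minT y Ty; apply.
case=> T0 upT minT; split.
  by apply/forall_inP=> y Ty; apply/forallP=> x; apply/implyP; apply: upT.
apply/existsP; exists ord0; rewrite /minimal_in T0 /=.
by apply/forall_inP=> y Ty; apply/implyP=> ge_0y; rewrite (minT y).
Qed.

Lemma bl_treeP n (b : bileveled n.+1) :
  [/\ ord0 \in bl_ideal b,
      forall x y : 'I_n.+1, y \in bl_ideal b -> node_ge (bl_tree b) x y ->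
        x \in bl_ideal b
    & forall y : 'I_n.+1, y \in bl_ideal b -> node_ge (bl_tree b) 0 y -> y = ord0].
Proof. by apply/is_bileveledP; case: b. Qed.

Lemma bileveled_leE n (s t : bileveled n) :
  (s <= t)%O = (bl_tree s <= bl_tree t)%O && (bl_ideal t \subset bl_ideal s).
Proof. by []. Qed.

(** A right ancestor x of a node in J also belongs to S and T, but only because J
    asks for it, whereas closure under left ancestors is automatic ([leftI] below);
    this is what lets the ideal of an arbitrary upper bound fit into J. *)
Lemma bileveled_join n (s t : bileveled n.+1) : exists j : bileveled n.+1,
  forall u, (j <= u)%O = (s <= u)%O && (t <= u)%O.
Proof.
have [s0 upS minS] := bl_treeP s; have [t0 upT minT] := bl_treeP t.
have [j lubj] := tamari_join (bl_tree s) (bl_tree t).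
have [le_sj le_tj] : (bl_tree s <= j)%O /\ (bl_tree t <= j)%O.
  by apply/andP; rewrite -lubj.
pose I := bl_ideal s :&: bl_ideal t.
pose J := [set y : 'I_n.+1 | [forall x : 'I_n.+1, node_ge j x y ==> (x \in I)]
                             && (node_ge j 0 y ==> (y == ord0))].
have leftI (x y : 'I_n.+1) : y \in I -> y <= x -> node_ge j x y -> x \in I.
  rewrite leq_eqVlt => Iy /orP[/eqP/val_inj <-//|lt_yx] ge_xy.
  case/setIP: Iy => Sy Ty; apply/setIP; split.
    by apply: upS Sy _; apply: tamari_le_left_anc ge_xy.
  by apply: upT Ty _; apply: tamari_le_left_anc ge_xy.
have blJ : is_bileveled j J.
  apply/is_bileveledP; split=> [|x y|y].
  - rewrite inE eqxx implybT andbT; apply/forallP=> x; apply/implyP.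
    by apply: leftI => //; apply/setIP.
  - rewrite !inE => /andP[/forallP Jy /implyP y0] ge_xy; apply/andP; split.
      apply/forallP=> z; apply/implyP=> ge_zx.
      by apply: implyP (Jy z) _; apply: node_ge_trans ge_xy.
    apply/implyP=> ge_0x; have /eqP def_y := y0 (node_ge_trans ge_0x ge_xy).
    rewrite def_y in ge_xy; apply/eqP/val_inj; exact: node_ge_anti ge_xy ge_0x.
  - by rewrite inE => /andP[_ /implyP y0] /y0/eqP.
have sJI : J \subset I.
  apply/subsetP=> y; rewrite inE => /andP[/forallP/(_ y)/implyP Jy _].
  by apply: Jy; rewrite node_ge_refl ?ytree_nodes.
pose b : bileveled n.+1 := @Bileveled n.+1 (j, J) blJ; exists b => u.
rewrite !bileveled_leE [bl_tree b]/= [bl_ideal b]/= lubj.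
case le_su: (bl_tree s <= bl_tree u)%O => //=.
case le_tu: (bl_tree t <= bl_tree u)%O; last by rewrite andbF.
rewrite /= -subsetI -/I; apply/idP/idP => [/subset_trans->//|/subsetP sUI].
have le_ju : (j <= bl_tree u)%O by rewrite lubj le_su.
have [u0 upU minU] := bl_treeP u.
apply/subsetP=> y Uy; rewrite inE; apply/andP; split.
  apply/forallP=> x; apply/implyP=> ge_xy.
  have [le_yx|lt_xy] := leqP y x; first exact: leftI (sUI _ Uy) _ ge_xy.
  by apply: sUI; apply: upU Uy _; apply: tamari_le_right_anc ge_xy.
apply/implyP=> ge_0y; have [y0|y_gt0] := posnP y; first by apply/eqP/val_inj.
by apply/eqP/minU => //; apply: tamari_le_right_anc ge_0y.
Qed.

(** In the left comb every node is an ancestor of all smaller ones, so node 0 has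
    no proper descendants and the ideal may consist of all nodes. *)
Lemma bileveled_bottom n : exists b : bileveled n.+1, forall u, (b <= u)%O.
Proof.
have [c ge_c] := tamari_bottom n.+1.
have blT : is_bileveled c [set: 'I_n.+1].
  apply/is_bileveledP; split=> [|x y _ _|y _ ge_0y]; rewrite ?inE //.
  have [y0|y_gt0] := posnP y; first exact/val_inj.
  by have := node_ge_anti ge_0y (ge_c _ _ y_gt0 (ltn_ord y)); lia.
exists (@Bileveled n.+1 (c, setT) blT) => u; rewrite bileveled_leE subsetT andbT.
apply/tamari_leP=> x y lt_yx ge_xy; apply: ge_c => //.
by have := node_ge_ltn ge_xy; rewrite ytree_nodes.
Qed.

(** * Finite join-semilattices with a bottom *)

(** The meet of x and y is the join of the list of all their lower bounds; the
    bottom is the join of the empty list. *)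
Lemma finite_join_lattice d (P : finPOrderType d) :
    (exists b : P, forall x, (b <= x)%O) ->
    (forall x y : P, exists j, forall z, (j <= z)%O = (x <= z)%O && (y <= z)%O) ->
  is_lattice P.
Proof.
move=> [b le_b] exj.
have exlub (s : seq P) : exists j, forall z, (j <= z)%O = all (fun x => x <= z)%O s.
  elim: s => [|x s [j lubj]]; first by exists b => z; rewrite le_b.
  by have [k lubk] := exj x j; exists k => z; rewrite lubk lubj.
have exm (x y : P) : exists m, [forall z, (z <= m)%O == (z <= x)%O && (z <= y)%O].
  have [m lubm] := exlub [seq z <- enum P | (z <= x)%O && (z <= y)%O].
  have le_m w : (forall z, (z <= x)%O -> (z <= y)%O -> (z <= w)%O) -> (m <= w)%O.
    move=> ubw; rewrite lubm; apply/allP=> z.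
    by rewrite mem_filter => /andP[/andP[le_zx /(ubw _ le_zx)]].
  exists m; apply/forallP=> z; apply/eqP; apply/idP/idP => [le_zm|/andP[le_zx le_zy]].
    by rewrite !(le_trans le_zm) ?le_m.
  have := lexx m; rewrite lubm => /allP; apply.
  by rewrite mem_filter le_zx le_zy mem_enum.
have {}exj (x y : P) : exists j, [forall z, (j <= z)%O == (x <= z)%O && (y <= z)%O].
  by have [j lubj] := exj x y; exists j; apply/forallP=> z; rewrite lubj.
have meetP (x y z : P) : (x <= xchoose (exm y z))%O = (x <= y)%O && (x <= z)%O.
  by apply/eqP; apply: (forallP (xchooseP (exm y z))).
have joinP (x y z : P) : (xchoose (exj x y) <= z)%O = (x <= z)%O && (y <= z)%O.
  by apply/eqP; apply: (forallP (xchooseP (exj x y))).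
pose latticeP := Order.POrder_MeetJoin_isLattice.Build d P meetP joinP.
pose L : latticeType d := HB.pack (Order.POrder.sort P) latticeP.
by exists L.
Qed.

Theorem theorem2p3 (n : nat) (hn : (1 <= n)%N) :
  is_lattice (bileveled n).
Proof.
case: n hn => // n _; apply: finite_join_lattice.
  exact: bileveled_bottom.
exact: bileveled_join.
Qed.
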